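(* Let $\gamma\in[0,2]$ and, for $v,v_1\in\mathbb R^3$, set $$F(v,v_1)=\int_{\mathbb S^2}\frac{|v-v_1|^\gamma}{\langle v^*\rangle^3}\,d\sigma,\qquad F_1(v,v_1)=\int_{\mathbb S^2}\frac{|v-v_1|^\gamma}{\langle v_1^*\rangle^3}\,d\sigma,$$ where $v^*=\frac{v+v_1}2+\frac{|v-v_1|}2\sigma$ and $v_1^*=\frac{v+v_1}2-\frac{|v-v_1|}2\sigma$. Then $$\|F\|_{L^\infty_{v,v_1}}\lesssim1,\qquad\|F_1\|_{L^\infty_{v,v_1}}\lesssim1 .$$
   Context: $\langle v\rangle=\sqrt{1+|v|^2}$; $d\sigma$ is surface measure on the unit sphere $\mathbb S^2\subset\mathbb R^3$; $A\lesssim B$ means $A\le CB$ for a numerical constant $C>0$. *)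

(* Defs.v *)
From HB Require Import structures.
From mathcomp Require Import all_boot all_order all_algebra.
From mathcomp Require Import all_classical all_reals all_analysis.
From mathcomp Require Import measurable_realfun ring.

Set Implicit Arguments.
Unset Strict Implicit.
Unset Printing Implicit Defensive.

Import Order.TTheory GRing.Theory Num.Theory.
Import numFieldNormedType.Exports.

Local Open Scope classical_set_scope.
Local Open Scope ring_scope.

(* [mvec3 R] is [vec3 R] carrying the product Borel sigma-algebra. *)
Notation vec3 R := (R * R * R)%type.
Notation mvec3 R :=
  (measurableTypeR R * measurableTypeR R * measurableTypeR R)%type.

Section euclidean.
Context {R : realType}.
Implicit Types v w : vec3 R.

Definition dot v w : R := v.1.1 * w.1.1 + v.1.2 * w.1.2 + v.2 * w.2.

(* The library norm [`|v|] on a product type is the sup norm, hence this one. *)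
Definition enorm v : R := Num.sqrt (dot v v).

Definition cross v w : vec3 R :=
  (v.1.2 * w.2 - v.2 * w.1.2,
   v.2 * w.1.1 - v.1.1 * w.2,
   v.1.1 * w.1.2 - v.1.2 * w.1.1).

Definition japanese v : R := Num.sqrt (1 + enorm v ^+ 2).

Definition S2 : set (vec3 R) := [set s | enorm s = 1].

End euclidean.

Section lebesgue.
Context {R : realType}.

(* The library canonically equips [m1 \x m2] with a sigma-finite structure only
   when m1 and m2 are finite, so the iterated products are named and given
   theirs by hand. *)
Lemma product_sigma_finite d1 d2 (T1 : measurableType d1)
    (T2 : measurableType d2) (m1 : {sigma_finite_measure set T1 -> \bar R})
    (m2 : {sigma_finite_measure set T2 -> \bar R}) :
  sigma_finite setT (m1 \x m2)%E.
Proof.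
have /sigma_finiteP[F [TF ndF Foo]] := sigma_finiteT m1.
have /sigma_finiteP[G [TG ndG Goo]] := sigma_finiteT m2.
exists (fun n => F n `*` G n).
  rewrite -setXTT TF TG predeqE => -[x y]; split.
    move=> [/= [n _ Fnx] [k _ Gky]]; exists (maxn n k) => //; split.
    - by move: x Fnx; exact/subsetPset/ndF/leq_maxl.
    - by move: y Gky; exact/subsetPset/ndG/leq_maxr.
  by move=> [n _ []/= ? ?]; split; exists n.
move=> k; have [? ?] := Foo k; have [? ?] := Goo k.
split; first exact: measurableX.
by rewrite product_measure1E// lte_mul_pinfty// ge0_fin_numE.
Qed.

Definition leb2 : set (measurableTypeR R * measurableTypeR R) -> \bar R :=
  (@lebesgue_measure R \x @lebesgue_measure R)%E.
HB.instance Definition _ := Measure.on leb2.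
HB.instance Definition _ := Measure_isSigmaFinite.Build _ _ _ leb2
  (product_sigma_finite _ _).

Definition leb3 : set (mvec3 R) -> \bar R := (leb2 \x @lebesgue_measure R)%E.
HB.instance Definition _ := Measure.on leb3.
HB.instance Definition _ := Measure_isSigmaFinite.Build _ _ _ leb3
  (product_sigma_finite _ _).

Definition leb6 : set (mvec3 R * mvec3 R) -> \bar R := (leb3 \x leb3)%E.
HB.instance Definition _ := Measure.on leb6.
HB.instance Definition _ := Measure_isSigmaFinite.Build _ _ _ leb6
  (product_sigma_finite _ _).

End lebesgue.

Section surface_measure.
Context {R : realType}.
Implicit Types (X : R * R -> vec3 R) (D : set (R * R)).

Definition area_element X (p : R * R) : R :=
  enorm (cross (derive1 (fun s : R => X (s, p.2)) p.1)
               (derive1 (fun t : R => X (p.1, t)) p.2)).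

(* For X injective on D up to a null set, this is the area of A inside the
   surface X(D): dS = |d_1 X x d_2 X| ds dt. *)
Definition surface_measure X D (A : set (mvec3 R)) : \bar R :=
  (\int[leb2]_(p in D `&` X @^-1` A)
     (area_element X p)%:E)%E.

Definition spherical (p : R * R) : vec3 R :=
  (sin p.1 * cos p.2, sin p.1 * sin p.2, cos p.1).

Definition spherical_dom : set (R * R) := `[0, pi] `*` `[0, 2 * pi].

Definition sphere_measure : set (mvec3 R) -> \bar R :=
  surface_measure spherical spherical_dom.

Lemma is_derive_pair (V W : normedModType R) (f : R -> V) (g : R -> W)
    (a : V) (b : W) (x : R) :
  is_derive x 1 f a -> is_derive x 1 g b ->
  is_derive x 1 (fun t => (f t, g t)) (a, b).
Proof.
move=> [df fa] [dg gb].
have h : (fun h : R => h^-1 *: (((fun t => (f t, g t)) \o shift x) (h *: 1)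
    - (f x, g x))) @ 0^' --> (a, b).
  rewrite -fa -gb; apply: cvg_pair; [exact: df|exact: dg].
split; first by apply/cvg_ex; exists (a, b).
exact: cvg_lim h.
Qed.

Lemma is_derive_mulr (f : R -> R) (df c x : R) :
  is_derive x 1 f df -> is_derive x 1 (fun t => f t * c) (df * c).
Proof.
move=> fdf; have := is_deriveM fdf (is_derive_cst c x 1).
by rewrite scaler0 add0r [_ *: _]mulrC; apply.
Qed.

Lemma is_derive_mull (f : R -> R) (df c x : R) :
  is_derive x 1 f df -> is_derive x 1 (fun t => c * f t) (c * df).
Proof.
move=> /(is_derive_mulr c); rewrite mulrC.
by under eq_fun do rewrite mulrC.
Qed.

Lemma area_element_spherical (p : R * R) :
  area_element spherical p = `|sin p.1|.
Proof.
case: p => s t; rewrite /area_element /spherical /=.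
have -> : derive1 (fun s : R => (sin s * cos t, sin s * sin t, cos s)) s
    = (cos s * cos t, cos s * sin t, - sin s).
  rewrite derive1E; apply: derive_val.
  apply: is_derive_pair; first apply: is_derive_pair.
  - exact: is_derive_mulr.
  - exact: is_derive_mulr.
have -> : derive1 (fun t : R => (sin s * cos t, sin s * sin t, cos s)) t
    = (- (sin s * sin t), sin s * cos t, 0).
  rewrite derive1E; apply: derive_val.
  apply: is_derive_pair; first apply: is_derive_pair.
by rewrite -mulrN; exact: is_derive_mull.
rewrite /enorm /dot /cross /=.
rewrite (_ : _ + _ = sin s ^+ 2); first by rewrite sqrtr_sqr.
have cs := cos2Dsin2 s; have ct := cos2Dsin2 t.
have ct2 : cos t ^+ 2 = 1 - sin t ^+ 2 by rewrite -ct addrK.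
have cs2 : cos s ^+ 2 = 1 - sin s ^+ 2 by rewrite -cs addrK.
by ring: ct2 cs2.
Qed.

Lemma measurable_spherical :
  measurable_fun [set: measurableTypeR R * measurableTypeR R]
    (spherical : _ -> mvec3 R).
Proof.
have m1 : measurable_fun [set: measurableTypeR R * measurableTypeR R]
    (fst : _ -> measurableTypeR R) by exact: measurable_fst.
have m2 : measurable_fun [set: measurableTypeR R * measurableTypeR R]
    (snd : _ -> measurableTypeR R) by exact: measurable_snd.
have ms : measurable_fun [set: measurableTypeR R]
   (@sin R : _ -> measurableTypeR R).
  by apply: continuous_measurable_fun; exact: continuous_sin.
have mc : measurable_fun [set: measurableTypeR R]
   (@cos R : _ -> measurableTypeR R).
  by apply: continuous_measurable_fun; exact: continuous_cos.
apply: measurable_fun_pair; first apply: measurable_fun_pair.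
- by apply: measurable_funM; exact: measurableT_comp.
- by apply: measurable_funM; exact: measurableT_comp.
- exact: measurableT_comp.
Qed.

Lemma measurable_area_element_spherical :
  measurable_fun [set: measurableTypeR R * measurableTypeR R]
    (fun p => (area_element spherical p)%:E).
Proof.
under eq_fun do rewrite area_element_spherical.
apply/measurable_EFinP; apply: measurableT_comp => //.
apply: (@measurableT_comp _ _ _ _ _ _ (@sin R : _ -> measurableTypeR R)) => //.
by apply: continuous_measurable_fun; exact: continuous_sin.
Qed.

Lemma measurable_spherical_dom :
  measurable (spherical_dom : set (measurableTypeR R * measurableTypeR R)).
Proof. by apply: measurableX; exact: measurable_itv. Qed.

Local Open Scope ereal_scope.

Let sphere_measure0 : sphere_measure set0 = 0.
Proof.
by rewrite /sphere_measure /surface_measure preimage_set0 setI0 integral_set0.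
Qed.

Let sphere_measure_ge0 A : 0 <= sphere_measure A.
Proof. by apply: integral_ge0 => p _; rewrite lee_fin sqrtr_ge0. Qed.

Let sphere_measure_sigma_additive : semi_sigma_additive sphere_measure.
Proof.
have mX A : measurable A ->
    measurable (spherical_dom `&` spherical @^-1` A :
      set (measurableTypeR R * measurableTypeR R)).
  move=> mA; apply: measurableI; first exact: measurable_spherical_dom.
  by rewrite -[X in measurable X]setTI; exact: measurable_spherical.
move=> F mF tF mUF; rewrite /sphere_measure /surface_measure.
rewrite preimage_bigcup setI_bigcupr.
apply: semi_sigma_additive_nng_induced.
- exact: measurable_area_element_spherical.
- by move=> p; rewrite lee_fin sqrtr_ge0.
- by move=> n; apply: mX; apply: mF.
- apply: trivIset_setIl; apply/trivIsetP => /= i j _ _ ij.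
  by rewrite -preimage_setI; move/trivIsetP : tF => /(_ _ _ Logic.I Logic.I ij) ->;
     rewrite preimage_set0.
- by rewrite -setI_bigcupr -preimage_bigcup; exact: mX.
Qed.

HB.instance Definition _ := isMeasure.Build _ _ _ sphere_measure
  sphere_measure0 sphere_measure_ge0 sphere_measure_sigma_additive.

End surface_measure.

Section collision.
Context {R : realType}.
Implicit Types v s : vec3 R.

Definition vstar v v1 s : vec3 R :=
  2^-1 *: (v + v1) + (enorm (v - v1) / 2) *: s.

Definition v1star v v1 s : vec3 R :=
  2^-1 *: (v + v1) - (enorm (v - v1) / 2) *: s.

(* The integrals take values in [\bar R]; for gamma = 0 and v = v1 the factor
   |v - v1|^gamma is [0 `^ 0 = 1]. *)
Definition F (gamma : R) (x : mvec3 R * mvec3 R) : \bar R :=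
  (\int[sphere_measure]_(s in S2)
     (enorm (x.1 - x.2 : vec3 R) `^ gamma /
        japanese (vstar x.1 x.2 s) ^+ 3)%:E)%E.

Definition F1 (gamma : R) (x : mvec3 R * mvec3 R) : \bar R :=
  (\int[sphere_measure]_(s in S2)
     (enorm (x.1 - x.2 : vec3 R) `^ gamma /
        japanese (v1star x.1 x.2 s) ^+ 3)%:E)%E.

End collision.

(* Main.v *)
Require Import Defs.
From mathcomp Require Import all_boot all_order all_algebra.
From mathcomp Require Import all_classical all_reals all_analysis.
From mathcomp Require Import measurable_realfun ess_sup_inf ring lra.

Import Order.TTheory GRing.Theory Num.Theory.
Import numFieldNormedType.Exports.

Local Open Scope ring_scope.

(** Put [r = |v - v1| / 2], so that both integrals have the form
    [(2 r)^gamma * int <u - r s>^-3 ds] over the unit sphere, up to the sign of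
    the centre [u]. For [2 r <= 1] the integrand is at most [1]. For [2 r > 1] we
    show that [int <u - r s>^-3 ds <= 64 pi^2 / r^2], uniformly in [u], and
    [(2 r)^gamma <= (2 r)^2]. If [w] is the direction of [u], then
    [|u - r s|^2 >= r^2 (1 - s.w) / 2]. With polar angles [a] of [s] and [a0] of
    [w], azimuthal difference [b], and [rho = r / 4], the inequality
    [1 - cos x >= x^2 / 8] for [|x| <= pi] gives
    [<u - r s>^2 >= 1 + rho^2 ((a - a0)^2 + sin a sin a0 b^2)].
    With [X = 1 + rho^2 (a - a0)^2], the azimuthal integral of
    [sin a / <u - r s>^3] is at most [4 pi / (rho X)]; both the azimuthal and the
    polar integrals reduce to that of [1 / (1 + x^2)]. *)

(** * Integration over the sphere in spherical coordinates *)

Section sphere_integral.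
Context {R : realType}.
Local Open Scope classical_set_scope.
Import HBNNSimple.
Local Open Scope ereal_scope.

(** The left side is a supremum over simple functions below [f] extended by zero off [D]. Since [f]
    is nonnegative, these also lie below [f], and for simple functions the change of variables
    follows from the definition of [sphere_measure]. *)
Lemma sphere_integral_le (D : set (mvec3 R)) (f : mvec3 R -> \bar R) :
  measurable_fun [set: mvec3 R] f -> (forall s, 0 <= f s) ->
  \int[sphere_measure]_(s in D) f s <=
  \int[leb2]_(p in spherical_dom) (f (spherical p) * (area_element spherical p)%:E).
Proof.
move=> mf f0.
have mA := @measurable_area_element_spherical R.
have A0 (p : R * R) : 0 <= (area_element spherical p)%:E by rewrite lee_fin sqrtr_ge0.
have mdom := @measurable_spherical_dom R.
have msph := @measurable_spherical R.
rewrite ge0_integralE//; apply: ge_ereal_sup => _ [h /= hf <-].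
rewrite sintegralE.
have mhs r : measurable (spherical @^-1` (h @^-1` [set r]) :
    set (measurableTypeR R * measurableTypeR R)).
  by rewrite -[X in measurable X]setTI; exact: msph.
apply: (@le_trans _ _ (\int[leb2]_(p in spherical_dom)
  ((h (spherical p))%:E * (area_element spherical p)%:E))); last first.
  apply: ge0_le_integral => //.
  - by move=> p _; rewrite mule_ge0// lee_fin; exact: fun_ge0.
  - apply: emeasurable_funM; last exact: measurable_funTS.
    apply: measurable_funTS; apply/measurable_EFinP.
    exact: (measurableT_comp (measurable_funP h)).
  - apply: emeasurable_funM; last exact: measurable_funTS.
    apply: measurable_funTS; exact: (measurableT_comp mf).
  - move=> p _; apply: lee_wpmul2r => //.
    apply: le_trans (hf _) _; rewrite /patch; case: ifP => // _; exact: f0.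
(* Equality holds for [h]: it splits over its level sets, and the measure of each is the integral of
   the area element over its preimage. *)
rewrite le_eqVlt; apply/orP; left; apply/eqP; under [RHS]eq_integral => p _.
  rewrite (fimfunE h (spherical p)) -fsumEFin//.
  rewrite ge0_mule_fsuml; last by move=> r; rewrite EFinM nnfun_muleindic_ge0.
  over.
rewrite ge0_integral_fsum//; last 2 first.
  - move=> r; apply: measurable_funTS; apply: emeasurable_funM => //.
    apply/measurable_EFinP; apply: measurable_funM => //.
    exact: (measurableT_comp (measurable_indic (measurable_funPTI h (measurable_set1 r)))).
  - by move=> r p _; rewrite mule_ge0// EFinM nnfun_muleindic_ge0.
apply: eq_fsbigr => r; rewrite inE => -[s _ <-].
under [RHS]eq_integral do rewrite EFinM -muleA.
rewrite ge0_integralZl//; last 3 first.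
  - apply: measurable_funTS; apply: emeasurable_funM => //.
    apply/measurable_EFinP.
    exact: (measurableT_comp (measurable_indic (measurable_funPTI h (measurable_set1 _)))).
  - by move=> p _; rewrite mule_ge0// lee_fin.
  - by rewrite lee_fin; exact: fun_ge0.
congr (_ * _); rewrite /= /sphere_measure /surface_measure integral_mkcondr.
apply: eq_integral => p _; rewrite /patch indicE.
have -> : (spherical p \in h @^-1` [set h s]) =
    (p \in spherical @^-1` (h @^-1` [set h s])).
  by apply/idP/idP; rewrite !inE.
by case: ifPn => _; rewrite ?mul1e ?mul0e.
Qed.
End sphere_integral.

(** * Elementary bounds on sine and cosine *)

Section trigonometry.
Context {R : realType}.
Local Open Scope classical_set_scope.
Implicit Types x y : R.

Lemma sin_lipschitz x y : `|sin x - sin y| <= `|x - y|.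
Proof.
wlog yx : x y / y <= x.
  by move=> H; have [/H//|/ltW/H] := leP y x; rewrite distrC [leRHS]distrC.
have [z _ ->] := MVT_segment yx (fun z _ => is_derive_sin z)
  (continuous_subspaceT (@continuous_sin R)).
by rewrite normrM ler_piMl// cos_max.
Qed.

(** By evenness take [x >= 0]. Then [1 - cos x = 8 cos(x/4)^2 sin(x/4)^2], and the mean value
    theorem gives [sin(x/4) = (x/4) cos z] with [0 <= z <= x/4]. Quarter angles stay below [pi / 4],
    so both squared cosines are at least [1/2]. *)
Lemma sqr_le_1Bcos x : `|x| <= pi -> x ^+ 2 / 8 <= 1 - cos x.
Proof.
rewrite -(cos_norm x) -(real_normK (num_real x)); move: `|x| (normr_ge0 x) => {}x x0 xpi.
have x40 : 0 <= x / 4 by rewrite divr_ge0.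
have [z zx] := MVT_segment x40 (fun z _ => is_derive_sin z)
  (continuous_subspaceT (@continuous_sin R)).
rewrite sin0 !subr0 => sE.
have pi0 := pi_gt0 R.
move: zx; rewrite in_itv/= => /andP[z0 zx].
have c4 : cos (x / 4) ^+ 2 *+ 2 >= 1.
  have := cos_mulr2n (x / 4); rewrite -subr_ge0 => <-.
  apply: cos_ge0_pihalf; rewrite -mulr_natr; apply/andP; split; lra.
have cz : cos (x / 4) <= cos z.
  have [->//|/eqP zx'] := eqVneq z (x / 4).
  apply: ltW; rewrite ltr_cos ?in_itv/=; try (apply/andP; split; lra).
  by rewrite lt_neqAle zx andbT; apply/eqP.
have c0 : 0 <= cos (x / 4) by apply: cos_ge0_pihalf; apply/andP; split; lra.
have E1 : 1 - cos x = sin (x / 2) ^+ 2 *+ 2.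
  have -> : cos x = cos ((x / 2) *+ 2) by rewrite -mulr_natr divfK.
  by rewrite cos_mulr2n cos2sin2; ring.
have E2 : sin (x / 2) = (cos (x / 4) * sin (x / 4)) *+ 2.
  by rewrite -sin_mulr2n; congr sin; rewrite -mulr_natr; field.
rewrite E1 E2 sE.
set c := cos (x / 4) in c4 cz c0 *; set d := cos z in cz *.
have cd : 1 <= (c * d) *+ 2.
  apply: le_trans c4 _; rewrite ler_wMn2r// expr2; exact: ler_wpM2l.
have : x ^+ 2 / 8 * 1 <= x ^+ 2 / 8 * ((c * d) *+ 2) ^+ 2.
  by rewrite ler_wpM2l ?divr_ge0 ?sqr_ge0// exprn_ege1.
rewrite mulr1 => /le_trans; apply; rewrite le_eqVlt; apply/orP; left; apply/eqP.
by field.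
Qed.

End trigonometry.

(** * Integrals of [1 / (1 + x^2)], rescaled and translated *)

Section atan_integral.
Context {R : realType}.
Local Open Scope classical_set_scope.
Local Notation mu := (@lebesgue_measure R).

(** The antiderivative [atan (k (x - x0)) / k] takes its values in an interval of length [pi / k],
    whatever the centre and the endpoints. *)
Lemma integral_inv_oneDsqr_le (k x0 a b : R) : 0 < k -> a < b ->
  (\int[mu]_(x in `[a, b]) ((1 + (k * (x - x0)) ^+ 2)^-1)%:E <= (pi / k)%:E)%E.
Proof.
move=> k0 ab.
pose G (x : R) := atan (k * (x - x0)) * k^-1.
have dG (x : R) : is_derive x 1 G (1 + (k * (x - x0)) ^+ 2)^-1.
  have dl : is_derive x 1 (fun x : R => k * (x - x0)) k.
    rewrite -[X in is_derive _ _ _ X]mulr1; apply: is_derive_mull.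
    rewrite -[X in is_derive _ _ _ X]addr0 -oppr0.
    by apply: is_deriveB.
  have := is_derive_mulr k^-1 (is_derive1_comp (is_derive1_atan _) dl).
  rewrite /comp/= -[X in is_derive _ _ _ X]mulrA divff ?gt_eqF// mulr1; exact.
have cG (x : R) : {for x, continuous G}.
  by apply: differentiable_continuous; apply/derivable1_diffP; exact: ex_derive.
rewrite (@continuous_FTC2 _ _ G)//.
- rewrite -EFinB lee_fin /G -mulrBl ler_pM2r ?invr_gt0//.
  have := @atan_ltpi2 R (k * (b - x0)); have := @atan_gtNpi2 R (k * (a - x0)); lra.
- apply: continuous_in_subspaceT => x _.
  apply: cvgV; first by rewrite gt_eqF// ltr_pwDl// sqr_ge0.
  have cl : {for x, continuous (fun x : R => k * (x - x0))}.
    by apply: cvgM; [exact: cvg_cst|apply: cvgB; [exact: cvg_id|exact: cvg_cst]].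
  apply: cvgD; first exact: cvg_cst.
  exact: (continuous_comp cl (@exprn_continuous _ 2 _)).
- split.
  + by move=> x _; apply: ex_derive.
  + by apply: cvg_at_right_filter; exact: cG.
  + by apply: cvg_at_left_filter; exact: cG.
- by move=> x _; rewrite derive1E derive_val.
Qed.
End atan_integral.

(** * Spherical coordinates and distances to points of the sphere *)

Section geometry.
Context {R : realType}.
Implicit Types u v w : vec3 R.

Lemma dot_ge0 v : 0 <= dot v v.
Proof. by rewrite /dot -!expr2 !addr_ge0// sqr_ge0. Qed.

Lemma enorm_sqr v : enorm v ^+ 2 = dot v v.
Proof. by rewrite sqr_sqrtr// dot_ge0. Qed.

(** Spherical law of cosines, arranged so that [1 - dot] is a polar term plus a weighted azimuthal
    term, both of the form [1 - cos]. *)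
Lemma dot_spherical (a b : R * R) :
  dot (spherical a) (spherical b) =
  cos (a.1 - b.1) - sin a.1 * sin b.1 * (1 - cos (a.2 - b.2)).
Proof. by rewrite /dot /spherical /= !cosB; ring. Qed.

Lemma dot_spherical_self (a : R * R) : dot (spherical a) (spherical a) = 1.
Proof. by rewrite dot_spherical !subrr cos0 subrr mulr0 subr0. Qed.

(** The azimuth is [acos (x / sin s)] with the sign of [y], hence the range from [-pi] to [pi]; at
    the poles the value [0] is taken. *)
Lemma spherical_surj w : dot w w = 1 ->
  exists s t : R, [/\ 0 <= s <= pi, - pi <= t <= pi & w = spherical (s, t)].
Proof.
case: w => -[x y] z; rewrite /dot /= => w1.
have z1 : -1 <= z <= 1.
  rewrite -ler_norml -(ler_pXn2r (ltn0Sn 1)) ?nnegrE// real_normK ?num_real//.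
  by rewrite expr1n; nra.
pose s := acos z; pose d := sin s.
have sz : cos s = z by rewrite /s acosK// in_itv.
have s0pi : 0 <= s <= pi by rewrite acos_ge0// acos_lepi.
have d0 : 0 <= d by exact: sin_ge0_pi.
have d2 : d ^+ 2 = x ^+ 2 + y ^+ 2 by rewrite /d sin2cos2 sz -w1; ring.
have pi0 := pi_ge0 R.
have [dE|dN0] := eqVneq d 0.
  exists s, 0; split => //; first by rewrite oppr_le0 pi0.
  rewrite /spherical /= -/d dE !mul0r sz.
  by congr (_, _, _); nra.
have dp : 0 < d by rewrite lt0r dN0.
pose q := x / d.
have xE : x = q * d by rewrite /q divfK.
have q1 : -1 <= q <= 1.
  by rewrite -ler_norml /q normrM normfV (gtr0_norm dp) ler_pdivrMr// mul1r
     -(ler_pXn2r (ltn0Sn 1)) ?nnegrE// real_normK ?num_real// d2; nra.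
have cq : cos (acos q) = q by rewrite acosK// in_itv.
have sq : sin (acos q) = `|y| / d.
  apply/eqP; rewrite -(@eqrXn2 _ 2)//; last 2 first.
  - by apply: sin_ge0_pi; rewrite acos_ge0// acos_lepi.
  - by rewrite divr_ge0.
  rewrite sin2cos2 cq /q exprMn !exprVn -/(_ / _) expr_div_n.
  rewrite real_normK ?num_real// d2; apply/eqP; field; rewrite -d2; exact: expf_neq0.
have a0 := acos_ge0 q1; have api := acos_lepi q1.
have [y0|y0] := leP 0 y.
  exists s, (acos q); split => //; first by apply/andP; split; lra.
  rewrite /spherical /= -/d sz cq sq ger0_norm//.
  by rewrite [d * q]mulrC -xE mulrCA divff// mulr1.
exists s, (- acos q); split => //; first by apply/andP; split; lra.
rewrite /spherical /= -/d sz cosN sinN cq sq ltr0_norm//.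
by rewrite [d * q]mulrC -xE mulNr opprK mulrCA divff// mulr1.
Qed.

(* The direction of [u] works: the point of the unit sphere nearest to [u / r]
   is at most twice as far from any other point of the sphere as [u / r] is. *)
Lemma exists_nearest_direction u (r : R) : 0 <= r ->
  exists2 w, dot w w = 1 & forall v, dot v v = 1 ->
    r ^+ 2 * ((1 - dot v w) / 2) <= dot (u - r *: v) (u - r *: v).
Proof.
move=> r0.
have [t [w [t0 w1 uE]]] : exists t w, [/\ 0 <= t, dot w w = 1 & u = t *: w].
  have [un0|un0] := eqVneq (enorm u) 0.
    exists 0, (0, 0, 1); split => //; first by rewrite /dot /=; ring.
    move/eqP: un0; rewrite -sqrf_eq0 enorm_sqr => /eqP.
    case: u => -[x y] z; rewrite /dot /= => E; rewrite scale0r.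
    by congr (_, _, _); nra.
  exists (enorm u), ((enorm u)^-1 *: u); split; first exact: sqrtr_ge0.
    transitivity ((enorm u)^-2 * dot u u); first by rewrite /dot /= /GRing.scale/=; field.
    by rewrite -enorm_sqr mulVf// expf_neq0.
  by rewrite scalerA divff// scale1r.
exists w => // v v1; rewrite uE.
have -> : dot (t *: w - r *: v) (t *: w - r *: v) =
    t ^+ 2 * dot w w - 2 * (t * r) * dot v w + r ^+ 2 * dot v v.
  by rewrite /dot /= /GRing.scale/=; ring.
rewrite w1 v1 !mulr1.
have q1 : dot v w <= 1.
  have := dot_ge0 (v - w).
  have -> : dot (v - w) (v - w) = dot v v + dot w w - 2 * dot v w by rewrite /dot/=; ring.
  rewrite v1 w1; lra.
have qN1 : -1 <= dot v w.
  have := dot_ge0 (v + w).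
  have -> : dot (v + w) (v + w) = dot v v + dot w w + 2 * dot v w by rewrite /dot/=; ring.
  rewrite v1 w1; lra.
move: (dot v w) q1 qN1 => q q1 qN1.
(* The difference of the two sides is [(t - r q)^2 + r^2 (1 - q) (1/2 + q)], used for [q >= 0]. It
   also equals [t^2 + 2 t r (-q) + r^2 (1 + q) / 2], used for [q < 0]. *)
have [q0|q0] := leP 0 q.
  have : 0 <= (t - r * q) ^+ 2 by exact: sqr_ge0.
  have : 0 <= r ^+ 2 * ((1 - q) * (1 / 2 + q)).
    by rewrite mulr_ge0 ?sqr_ge0// mulr_ge0; lra.
  lra.
have : 0 <= t * r * - q by rewrite mulr_ge0 ?mulr_ge0; lra.
have : 0 <= r ^+ 2 * (1 + q) by rewrite mulr_ge0 ?sqr_ge0; lra.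
have : 0 <= t ^+ 2 by exact: sqr_ge0.
lra.
Qed.

Lemma japanese_sqr v : japanese v ^+ 2 = 1 + dot v v.
Proof. by rewrite /japanese enorm_sqr sqr_sqrtr// addr_ge0 ?dot_ge0. Qed.

(* Here [0 <= t <= 2 pi] while the azimuth satisfies [-pi <= t0 <= pi], so that one
   of the two representatives [t1] of [t0] is within [pi] of [t]. *)
Lemma japanese_sphere_ge u (r : R) : 0 <= r ->
  exists s0 t0 : R, 0 <= s0 <= pi /\
    forall s t : R, 0 <= s <= pi -> 0 <= t <= 2 * pi ->
      exists2 t1, t1 = t0 \/ t1 = t0 + 2 * pi &
        1 + (r / 4) ^+ 2 * ((s - s0) ^+ 2 + sin s * sin s0 * (t - t1) ^+ 2) <=
        japanese (u - r *: spherical (s, t)) ^+ 2.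
Proof.
move=> r0; have [w w1 uw] := exists_nearest_direction u _ r0.
have [s0 [t0 [s0pi t0pi wE]]] := spherical_surj _ w1.
exists s0, t0; split => // s t spi tpi.
have pi0 := pi_ge0 R.
have [t1 t1E [tb tc]] : exists2 t1, t1 = t0 \/ t1 = t0 + 2 * pi &
    `|t - t1| <= pi /\ cos (t - t0) = cos (t - t1).
  have [tt|tt] := leP (t - t0) pi.
    by exists t0; [left|split=> //; rewrite ler_norml; apply/andP; split; lra].
  exists (t0 + 2 * pi); first by right.
  split; first by rewrite ler_norml; apply/andP; split; lra.
  by rewrite -(cosD2pi (t - (t0 + 2 * pi))); congr cos; ring.
exists t1 => //; rewrite japanese_sqr lerD2l.
apply: le_trans (uw _ (dot_spherical_self _)).
rewrite wE dot_spherical /= tc.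
have ss0 : 0 <= sin s * sin s0 by rewrite mulr_ge0 ?sin_ge0_pi.
have : `|s - s0| <= pi by rewrite ler_norml; apply/andP; split; lra.
move=> /sqr_le_1Bcos hs; have ht := sqr_le_1Bcos _ tb.
have : 0 <= sin s * sin s0 * (1 - cos (t - t1) - (t - t1) ^+ 2 / 8).
  by rewrite mulr_ge0// subr_ge0.
(* The [16] in [(r / 4)^2] is [8] from the cosine bound times [2] from the nearest-direction
   estimate. *)
have -> : (r / 4) ^+ 2 * ((s - s0) ^+ 2 + sin s * sin s0 * (t - t1) ^+ 2) =
  r ^+ 2 * (((s - s0) ^+ 2 / 8 + sin s * sin s0 * ((t - t1) ^+ 2 / 8)) / 2) by field.
move=> H; rewrite ler_wpM2l ?sqr_ge0//; lra.
Qed.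

End geometry.

(** * Decay of the spherical integral in the radius, uniformly in the centre *)

Section sphere_bound.
Context {R : realType}.
Local Open Scope classical_set_scope.
Local Notation mu := (@lebesgue_measure R).

Lemma japanese_ge1 (v : vec3 R) : 1 <= japanese v.
Proof.
rewrite -(ler_pXn2r (ltn0Sn 1)) ?nnegrE ?sqrtr_ge0//.
by rewrite expr1n japanese_sqr lerDl dot_ge0.
Qed.

Lemma measurable_inv_japanese_cube (u : vec3 R) (r : R) :
  measurable_fun [set: mvec3 R]
    (fun s => (japanese (u - r *: (s : vec3 R)) ^+ 3)^-1).
Proof.
under eq_fun => s.
  rewrite -powR_inv1 ?exprn_ge0 ?sqrtr_ge0// /japanese enorm_sqr /dot /=.
  over.
apply: (@measurableT_comp _ _ _ _ _ _ (@powR R ^~ (-1))); first exact: measurable_powR.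
apply: measurable_funX.
apply: (@measurableT_comp _ _ _ _ _ _ (@Num.sqrt R : _ -> measurableTypeR R)).
  by apply: continuous_measurable_fun; exact: sqrt_continuous.
have m11 : measurable_fun [set: mvec3 R] (fun s : mvec3 R => s.1.1 : measurableTypeR R).
  exact: (measurableT_comp measurable_fst measurable_fst).
have m12 : measurable_fun [set: mvec3 R] (fun s : mvec3 R => s.1.2 : measurableTypeR R).
  exact: (measurableT_comp measurable_snd measurable_fst).
have m2 : measurable_fun [set: mvec3 R] (fun s : mvec3 R => s.2 : measurableTypeR R).
  exact: measurable_snd.
apply: measurable_funD => //.
have mM (c : R) (h : mvec3 R -> measurableTypeR R) : measurable_fun setT h ->
    measurable_fun [set: mvec3 R] (fun s => (c - r * h s) * (c - r * h s)).
  by move=> mh; apply: measurable_funM; apply: measurable_funB => //;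
    apply: measurable_funM.
have := mM u.1.1 _ m11; have := mM u.1.2 _ m12; have := mM u.2 _ m2.
move=> h2 h12 h11; exact: measurable_funD (measurable_funD h11 h12) h2.
Qed.

Definition sphere_density (u : vec3 R) (r : R) (p : R * R) : R :=
  (japanese (u - r *: spherical p) ^+ 3)^-1 * area_element spherical p.

Lemma sphere_density_ge0 u r p : 0 <= sphere_density u r p.
Proof. by rewrite mulr_ge0 ?invr_ge0 ?exprn_ge0 ?sqrtr_ge0. Qed.

Lemma measurable_sphere_density u r :
  measurable_fun [set: measurableTypeR R * measurableTypeR R] (sphere_density u r).
Proof.
apply: measurable_funM; last first.
  by apply/measurable_EFinP; exact: measurable_area_element_spherical.
exact: (measurableT_comp (measurable_inv_japanese_cube u r) measurable_spherical).
Qed.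

Lemma sphere_density_le u r s t d :
  0 < d -> d ^+ 2 <= japanese (u - r *: spherical (s, t)) ^+ 2 ->
  0 <= s <= pi -> sphere_density u r (s, t) <= sin s / d ^+ 3.
Proof.
move=> d0 dJ spi; rewrite /sphere_density area_element_spherical/=.
rewrite ger0_norm ?sin_ge0_pi// mulrC ler_wpM2l ?sin_ge0_pi//.
have J0 := lt_le_trans ltr01 (japanese_ge1 (u - r *: spherical (s, t))).
rewrite lef_pV2 ?posrE ?exprn_gt0// lerXn2r// ?nnegrE ?(ltW d0) ?(ltW J0)//.
by rewrite -(ler_pXn2r (ltn0Sn 1)) ?nnegrE ?(ltW d0) ?(ltW J0).
Qed.

Lemma measurable_inv_oneDsqr (k t1 : R) :
  measurable_fun [set: measurableTypeR R]
    (fun t => (1 + (k * (t - t1)) ^+ 2)^-1).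
Proof.
under eq_fun do rewrite -powR_inv1 ?addr_ge0 ?sqr_ge0//.
apply: (@measurableT_comp _ _ _ _ _ _ (@powR R ^~ (-1))); first exact: measurable_powR.
apply: measurable_funD => //; apply: measurable_funX; apply: measurable_funM => //.
exact: measurable_funB.
Qed.

(** The bound is again a multiple of [1 / (1 + x^2)] in the polar angle, with [s0] independent of
    [s], so the polar integral can be estimated by the same arctangent bound. *)
Lemma sphere_density_inner_le (u : vec3 R) (r : R) : 0 < r ->
  exists s0 : R, forall s : R, 0 <= s <= pi ->
    (\int[mu]_(t in `[0%R, (2 * pi)%R]) (sphere_density u r (s, t))%:E <=
      (4 * pi / (r / 4) * (1 + (r / 4 * (s - s0)) ^+ 2)^-1)%:E)%E.
Proof.
move=> r_gt0; have [s0 [t0 [s0pi J2]]] := japanese_sphere_ge u r (ltW r_gt0).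
exists s0 => s spi.
have pi0 := pi_gt0 R.
have rho0 : 0 < r / 4 by rewrite divr_gt0.
move: (r / 4) rho0 J2 => rho rho0 J2.
set X := 1 + (rho * (s - s0)) ^+ 2.
have X1 : 1 <= X by rewrite lerDl sqr_ge0.
have X0 : 0 < X by lra.
pose x := Num.sqrt X.
have x0 : 0 < x by rewrite sqrtr_gt0.
have x2 : x ^+ 2 = X by rewrite sqr_sqrtr// ltW.
have sin0 : 0 <= sin s by exact: sin_ge0_pi.
have sins0 : 0 <= sin s0 by exact: sin_ge0_pi.
have mden : measurable_fun [set: measurableTypeR R]
    (fun t => sphere_density u r (s, t)).
  exact: (measurableT_comp (measurable_sphere_density u r) (pair1_measurable _)).
have den0 t : (0 <= (sphere_density u r (s, t))%:E)%E by rewrite lee_fin sphere_density_ge0.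
have mI : measurable (`[0, 2 * pi] : set (measurableTypeR R)) by exact: measurable_itv.
(* Either [sin s] is controlled by [|s - s0|], and dropping the azimuthal term
   loses nothing, or [sin s0 >= sin s / 2], and the azimuthal term makes the
   density integrable in [t] against [1 / (1 + (k (t - t1))^2)]. *)
have [sa|sa] := leP (sin s) (2 * `|s - s0|).
  (* Since [rho |s - s0| <= x], one has [sin s <= 2 x / rho], whence [sin s / x^3 <= 2 / (rho X)];
     the interval has length [2 pi]. *)
  have H t : t \in `[0, 2 * pi]%R -> sphere_density u r (s, t) <= 2 / (rho * X).
    rewrite in_itv/= => tpi.
    apply: (@le_trans _ _ (sin s / x ^+ 3)).
      apply: sphere_density_le => //.
      have [t1 _] := J2 s t spi tpi; apply: le_trans.
      rewrite x2 /X lerD2l exprMn ler_wpM2l ?sqr_ge0// lerDl.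
      by rewrite mulr_ge0 ?sqr_ge0// mulr_ge0.
    rewrite exprSr x2 ler_pdivrMr; last by rewrite mulr_gt0.
    have -> : 2 / (rho * X) * (X * x) = 2 * x / rho.
      by field; rewrite !gt_eqF.
    rewrite ler_pdivlMr//; apply: le_trans (_ : (2 * `|s - s0|) * rho <= _).
      by rewrite ler_wpM2r// ltW.
    rewrite -mulrA ler_wpM2l// -(ler_pXn2r (ltn0Sn 1)) ?nnegrE ?mulr_ge0
      ?(ltW x0) ?(ltW rho0)//.
    by rewrite x2 exprMn real_normK ?num_real// /X exprMn; lra.
  apply: (@le_trans _ _ (\int[mu]_(t in `[0%R, (2 * pi)%R])
      (cst (2 / (rho * X))%:E t))%E).
    apply: ge0_le_integral => //.
    by apply/measurable_EFinP; exact: measurable_funTS.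
  rewrite integral_cst//= lebesgue_measure_itv/= lte_fin mulr_gt0// -EFinB -EFinM lee_fin.
  by rewrite le_eqVlt; apply/orP; left; apply/eqP; rewrite -/X; field; rewrite !gt_eqF.
have sin_gt0 : 0 < sin s by apply: le_lt_trans sa; rewrite mulr_ge0.
have sin2 : sin s / 2 <= sin s0.
  have := sin_lipschitz s s0; have := ler_norm (sin s - sin s0); lra.
(* With this [k], [X (1 + k^2 (t - t1)^2)] is [X + rho^2 (sin s / 2)^2 (t - t1)^2], and
   [(sin s / 2)^2 <= sin s sin s0]. The factor [sin s] of [k] later cancels that of the area
   element. *)
pose k := rho * (sin s / 2) / x.
have k0 : 0 < k by rewrite /k divr_gt0// mulr_gt0// divr_gt0.
pose g t1 (t : R) := sin s / (x * X) * (1 + (k * (t - t1)) ^+ 2)^-1.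
have c0 : 0 <= sin s / (x * X) by rewrite divr_ge0// ltW// mulr_gt0.
have q0 t1 t : 0 <= (1 + (k * (t - t1)) ^+ 2)^-1 by rewrite invr_ge0 addr_ge0 ?sqr_ge0.
have g0 t1 t : 0 <= g t1 t by rewrite mulr_ge0.
have mq t1 := measurable_inv_oneDsqr k t1.
have mg t1 : measurable_fun [set: measurableTypeR R] (EFin \o (g t1)).
  by apply/measurable_EFinP; apply: measurable_funM.
(* The representative [t1] varies with [t]; adding the bounds for both candidates removes this
   dependence. Each contributes [2 pi / (rho X)] to the integral. *)
have H t : t \in `[0, 2 * pi]%R ->
    sphere_density u r (s, t) <= g t0 t + g (t0 + 2 * pi) t.
  rewrite in_itv/= => tpi; have [t1 t1E Jt] := J2 s t spi tpi.
  apply: (@le_trans _ _ (g t1 t)); last by case: t1E => ->; rewrite (lerDl, lerDr).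
  pose Y := X * (1 + (k * (t - t1)) ^+ 2).
  have kX : X * (k * (t - t1)) ^+ 2 = (rho * (sin s / 2) * (t - t1)) ^+ 2.
    by rewrite -x2 /k; field; rewrite gt_eqF.
  have XY : X <= Y by rewrite /Y mulrDr mulr1 lerDl kX sqr_ge0.
  have Y0 : 0 < Y by lra.
  have YJ : Y <= japanese (u - r *: spherical (s, t)) ^+ 2.
    apply: le_trans Jt; rewrite /Y mulrDr mulr1 kX /X.
    rewrite [rho ^+ 2 * _]mulrDr addrA -(exprMn 2 rho (s - s0)) lerD2l 2!exprMn -mulrA.
    rewrite ler_wpM2l ?sqr_ge0// ler_wpM2r ?sqr_ge0//.
    by rewrite expr2; apply: ler_pM => //; lra.
  apply: (@le_trans _ _ (sin s / Num.sqrt Y ^+ 3)).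
    by apply: sphere_density_le; rewrite ?sqrtr_gt0// sqr_sqrtr// ltW.
  (* In [Y^(3/2)] only the factor [sqrt Y] is weakened, to [x]; the remaining [Y] supplies the
     profile [1 / (1 + k^2 (t - t1)^2)]. *)
  rewrite /g -mulrA -invfM ler_wpM2l//.
  have -> : x * X * (1 + (k * (t - t1)) ^+ 2) = x * Y by rewrite /Y mulrA.
  rewrite exprS sqr_sqrtr ?(ltW Y0)//.
  have y0 : 0 < Num.sqrt Y by rewrite sqrtr_gt0.
  have xY0 : 0 < x * Y := mulr_gt0 x0 Y0.
  have yY0 : 0 < Num.sqrt Y * Y := mulr_gt0 y0 Y0.
  rewrite lef_pV2 ?posrE// ler_wpM2r ?(ltW Y0)//.
  by rewrite /x ler_wsqrtr.
have Ig t1 : (\int[mu]_(t in `[0%R, (2 * pi)%R]) (g t1 t)%:E <=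
    (sin s / (x * X) * (pi / k))%:E)%E.
  under eq_integral do rewrite EFinM.
  rewrite ge0_integralZl//; last 2 first.
  - by apply: measurable_funTS; apply/measurable_EFinP.
  - by move=> t _; rewrite lee_fin.
  rewrite [leRHS]EFinM; apply: lee_wpmul2l => //.
  by apply: integral_inv_oneDsqr_le => //; rewrite mulr_gt0.
apply: (@le_trans _ _ (\int[mu]_(t in `[0%R, (2 * pi)%R])
    ((g t0 t)%:E + (g (t0 + 2 * pi) t)%:E))%E).
  apply: ge0_le_integral => //.
  - by apply/measurable_EFinP; exact: measurable_funTS.
  - exact: (emeasurable_funD (measurable_funTS (mg _)) (measurable_funTS (mg _))).
rewrite ge0_integralD//; last 4 first.
- by move=> t _; rewrite lee_fin.
- exact: (measurable_funTS (mg _)).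
- by move=> t _; rewrite lee_fin.
- exact: (measurable_funTS (mg _)).
apply: le_trans (leeD (Ig _) (Ig _)) _; rewrite -EFinD lee_fin.
rewrite le_eqVlt; apply/orP; left; apply/eqP; rewrite -/X /k.
by field; rewrite !gt_eqF.
Qed.

(** By Tonelli, with the azimuth innermost, the polar integral of [1 / X] is at most [pi / rho]. The
    constant is [(4 pi / rho) (pi / rho)] at [rho = r / 4]. *)
Lemma sphere_density_integral_le (u : vec3 R) (r : R) : 0 < r ->
  (\int[leb2]_(p in spherical_dom) (sphere_density u r p)%:E <=
    (64 * pi ^+ 2 / r ^+ 2)%:E)%E.
Proof.
move=> r0; have [s0 Is] := sphere_density_inner_le u _ r0.
have mden := measurable_sphere_density u r.
have mdom := @measurable_spherical_dom R.
have den0 p : (0 <= (sphere_density u r p)%:E)%E by rewrite lee_fin sphere_density_ge0.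
have rho0 : 0 < r / 4 by rewrite divr_gt0.
have pi0 := pi_gt0 R.
have mr : measurable_fun [set: measurableTypeR R * measurableTypeR R]
    ((fun p => (sphere_density u r p)%:E) \_ spherical_dom).
  apply/(measurable_restrictT _ _).1 => //.
  by apply: measurable_funTS; apply/measurable_EFinP.
have mr0 p : (0 <= ((fun p => (sphere_density u r p)%:E) \_ spherical_dom) p)%E.
  by apply: erestrict_ge0 => // q _; exact: den0.
rewrite integral_mkcond /leb2 fubini_tonelli1//.
rewrite /fubini_F.
apply: (@le_trans _ _ (\int[mu]_(s in `[0%R, pi])
   (4 * pi / (r / 4) * (1 + (r / 4 * (s - s0)) ^+ 2)^-1)%:E)%E).
  rewrite [leRHS]integral_mkcond; apply: ge0_le_integral => //.
  - by move=> s _; apply: integral_ge0 => t _; exact: mr0.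
  - exact: (measurable_fun_fubini_tonelli_F _ mr mr0).
  - apply/(measurable_restrictT _ _).1; first exact: measurable_itv.
    apply: measurable_funTS; apply/measurable_EFinP; apply: measurable_funM => //.
    exact: measurable_inv_oneDsqr.
  - move=> s _; rewrite [leRHS]/patch; case: ifPn => [|sN].
      rewrite inE/= in_itv/= => spi; apply: le_trans (Is s spi).
      rewrite [leRHS]integral_mkcond le_eqVlt; apply/orP; left; apply/eqP.
      apply: eq_integral => t _; rewrite /patch; congr (if _ then _ else _).
      apply/idP/idP; rewrite !inE/=.
        by case.
      by move=> ?; split => //=; rewrite in_itv.
    rewrite integral0_eq// => t _; rewrite /patch ifN//.
    by apply: contra sN; rewrite !inE => -[].
under eq_integral do rewrite EFinM.
have q0 s : 0 <= (1 + (r / 4 * (s - s0)) ^+ 2)^-1 by rewrite invr_ge0 addr_ge0 ?sqr_ge0.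
rewrite ge0_integralZl//; last 3 first.
- by apply: measurable_funTS; apply/measurable_EFinP; exact: measurable_inv_oneDsqr.
- by move=> s _; rewrite lee_fin.
- by rewrite lee_fin divr_ge0 ?mulr_ge0// ltW.
apply: (@le_trans _ _ ((4 * pi / (r / 4))%:E * (pi / (r / 4))%:E)%E).
  apply: lee_wpmul2l; first by rewrite lee_fin divr_ge0 ?mulr_ge0// ltW.
  exact: integral_inv_oneDsqr_le.
rewrite -EFinM lee_fin le_eqVlt; apply/orP; left; apply/eqP.
by field; rewrite gt_eqF.
Qed.
End sphere_bound.

(** * Bounds on the collision integrals and their essential suprema *)

Section collision_bound.
Context {R : realType}.
Local Open Scope classical_set_scope.

(** Both factors of the density are at most [1], and the parameter rectangle has area [2 pi^2]. This
    covers small radii, where the decay estimate blows up. *)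
Lemma sphere_density_integral_le_mass (u : vec3 R) (r : R) :
  (\int[leb2]_(p in spherical_dom) (sphere_density u r p)%:E <= (2 * pi ^+ 2)%:E)%E.
Proof.
have mdom := @measurable_spherical_dom R.
have pi0 := pi_gt0 R.
apply: (@le_trans _ _ (\int[leb2]_(p in spherical_dom) (cst 1%E p))%E).
  apply: ge0_le_integral => //.
  - by move=> p _; rewrite lee_fin sphere_density_ge0.
  - apply: measurable_funTS; apply/measurable_EFinP; exact: measurable_sphere_density.
  - move=> p _; rewrite lee_fin /sphere_density area_element_spherical.
    rewrite mulr_ile1 ?invr_ge0 ?exprn_ge0 ?sqrtr_ge0 ?sin_max//.
    by rewrite invf_le1 ?exprn_ege1 ?exprn_gt0 ?(lt_le_trans ltr01) ?japanese_ge1.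
have mI (b : R) : measurable (`[0, b] : set (measurableTypeR R)) by exact: measurable_itv.
have mass : leb2 (spherical_dom : set (R * R)) =
    (@lebesgue_measure R `[0%R, pi] * @lebesgue_measure R `[0%R, (2 * pi)%R])%E.
  exact: product_measure1E.
rewrite integral_cst// mul1e [leLHS]mass !lebesgue_measure_itv/= !lte_fin mulr_gt0// pi0.
rewrite -!EFinB -EFinM lee_fin.
rewrite le_eqVlt; apply/orP; left; apply/eqP; ring.
Qed.

(** For [d <= 1], [gamma >= 0] gives [d^gamma <= 1] and the mass bound suffices. For [d > 1],
    [gamma <= 2] gives [d^gamma <= d^2], which cancels the decay:
    [d^2 * 64 pi^2 / (d / 2)^2 = 256 pi^2]. *)
Lemma collision_integral_le (gamma d : R) (u : vec3 R) :
  0 <= gamma <= 2 -> 0 <= d ->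
  (\int[sphere_measure]_(s in S2)
    (d `^ gamma / japanese (u - (d / 2) *: (s : vec3 R)) ^+ 3)%:E <=
   (256 * pi ^+ 2)%:E)%E.
Proof.
move=> /andP[g0 g2] d0.
have mJ := measurable_inv_japanese_cube u (d / 2).
have pi0 : 0 <= pi ^+ 2 :> R by rewrite sqr_ge0.
apply: le_trans (sphere_integral_le _ _ _ _) _.
- by apply/measurable_EFinP; apply: measurable_funM.
- by move=> s; rewrite lee_fin divr_ge0 ?powR_ge0 ?exprn_ge0 ?sqrtr_ge0.
under eq_integral => p _ do rewrite -EFinM -mulrA EFinM -/(sphere_density _ _ _).
rewrite ge0_integralZl//; last 4 first.
- exact: measurable_spherical_dom.
- by apply: measurable_funTS; apply/measurable_EFinP; exact: measurable_sphere_density.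
- by move=> p _; rewrite lee_fin sphere_density_ge0.
- by rewrite lee_fin powR_ge0.
have [d1|d1] := leP d 1.
  apply: (@le_trans _ _ (1 * (2 * pi ^+ 2)%:E)%E).
    apply: lee_pmul; rewrite ?lee_fin ?powR_ge0 ?sphere_density_integral_le_mass//.
      by apply: integral_ge0 => p _; rewrite lee_fin sphere_density_ge0.
    have := ge0_ler_powR g0; move=> /(_ d 1); rewrite !nnegrE powR1; exact.
  by rewrite mul1e lee_fin; lra.
have d_gt0 : 0 < d by lra.
apply: (@le_trans _ _ ((d ^+ 2)%:E * (64 * pi ^+ 2 / (d / 2) ^+ 2)%:E)%E).
  apply: lee_pmul; rewrite ?lee_fin ?powR_ge0//.
  - by apply: integral_ge0 => p _; rewrite lee_fin sphere_density_ge0.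
  - by rewrite -powR_mulrn// ler_powR// ltW.
  - by apply: sphere_density_integral_le; rewrite divr_gt0.
rewrite -EFinM lee_fin le_eqVlt; apply/orP; left; apply/eqP.
by field; rewrite gt_eqF.
Qed.

Lemma Lnorm_oo_le {d} {T : measurableType d} (m : {measure set T -> \bar R})
    (f : T -> \bar R) (C : R) :
  0 <= C -> (forall x, (0 <= f x <= C%:E)%E) -> ('N[m]_+oo[f] <= C%:E)%E.
Proof.
(* On a space of measure zero the norm is [0] by convention; that branch uses [0 <= C]. *)
move=> C0 fC; rewrite unlock; case: ifPn => _; last by rewrite lee_fin.
by apply/ess_supP/nearW => x /=; have /andP[f0 fxC] := fC x; rewrite gee0_abs.
Qed.

(** Since [japanese] is even, the plus sign in [vstar] is absorbed by taking minus the midpoint of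
    the two velocities as centre. *)
Lemma F_bound (gamma : R) (x : mvec3 R * mvec3 R) : 0 <= gamma <= 2 ->
  (0 <= F gamma x <= (256 * pi ^+ 2)%:E)%E.
Proof.
move=> g; apply/andP; split.
  by apply: integral_ge0 => s _; rewrite lee_fin divr_ge0 ?powR_ge0 ?exprn_ge0 ?sqrtr_ge0.
apply: le_trans (collision_integral_le gamma _ (- (2^-1 *: (x.1 + x.2 : vec3 R))) g
  (sqrtr_ge0 (dot (x.1 - x.2) (x.1 - x.2)))).
rewrite le_eqVlt; apply/orP; left; apply/eqP; apply: eq_integral => s _.
rewrite /vstar -opprD; congr ((_ / _ ^+ 3)%:E).
by rewrite /japanese !enorm_sqr /dot /= !mulrNN.
Qed.

Lemma F1_bound (gamma : R) (x : mvec3 R * mvec3 R) : 0 <= gamma <= 2 ->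
  (0 <= F1 gamma x <= (256 * pi ^+ 2)%:E)%E.
Proof.
move=> g; apply/andP; split; last exact: collision_integral_le _ _ _ g (sqrtr_ge0 _).
by apply: integral_ge0 => s _; rewrite lee_fin divr_ge0 ?powR_ge0 ?exprn_ge0 ?sqrtr_ge0.
Qed.

End collision_bound.

Theorem lemma2p1 (R : realType) :
  exists C : R, 0 < C /\
    forall gamma : R, 0 <= gamma <= 2 ->
      ('N[leb6]_+oo[F gamma] <= C%:E)%E /\
      ('N[leb6]_+oo[F1 gamma] <= C%:E)%E.
Proof.
have C0 : 0 < 256 * pi ^+ 2 :> R by rewrite mulr_gt0// exprn_gt0// pi_gt0.
exists (256 * pi ^+ 2); split => // gamma g.
split; apply: Lnorm_oo_le => [|x]; [exact: ltW|exact: F_bound|exact: ltW|exact: F1_bound].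
Qed.
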